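(* Assume the periodicity assumption and assumption (H) of the context, with its constant $\theta_0$, functions $V,\eta$ and probability measure $\nu$. Let $\mu$ be a probability measure on $E$ such that $\sum_{i=0}^{t-1}\mu|_{A_i}P_{t-i}V<+\infty$ and $\sum_{i=0}^{t-1}\mu|_{A_i}P_{t-i}\eta>0$. Then the conditional distributions $\mathbb P_\mu(X_n\in\cdot\mid n<\tau_\partial)$ converge in total variation, as $n\to+\infty$, to a quasi-stationary distribution if and only if the quantity $\theta_0^{\,i}\,\mu|_{A_i}P_{t-i}\eta$ does not depend on $i\in\{0,\dots,t-1\}$.
   Context: Let $E$ be a measurable space, $\partial\notin E$, and let $(X_n)_{n\in\mathbb Z_+}$ be a Markov chain on $E\cup\{\partial\}$ for which $\partial$ is absorbing; $\mathbb P_x$ (resp. $\mathbb P_\mu$) is its law started from $x$ (resp. from the distribution $\mu$), and $\tau_\partial=\inf\{n\ge 0: X_n=\partial\}$. Its sub-Markov semigroup on $E$ is $P_nf(x)=\mathbb E_x(f(X_n)\mathbf 1_{n<\tau_\partial})$ for $f$ bounded or nonnegative measurable on $E$; for a positive measure $\mu$ on $E$, $\mu P_nf=\int_E P_nf\,d\mu$. $\mu|_{A}$ denotes the restriction $\mu(\cdot\cap A)$. A quasi-stationary distribution is a probability measure $\pi$ on $E$ with $\mathbb P_\pi(X_n\in\cdot\mid n<\tau_\partial)=\pi$ for all $n\in\mathbb Z_+$. Periodicity assumption: for a positive integer $t$, $E$ is the disjoint union of measurable sets $A_0,\dots,A_{t-1}$ such that for all $x\in A_i$, $P_1\mathbf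 1_{A_j}(x)=0$ if $j\ne i+1$ and $P_1\mathbf 1_{A_j}(x)=P_1\mathbf 1_E(x)$ if $j=i+1$, with the convention $i+1=0$ if $i=t-1$. $Q_k:=P_{kt}$, $k\ge0$, acts on functions on $A_0$. Functions on $A_0$ and measures on $A_0$ are extended by $0$ to $E\setminus A_0$. Assumption (H): there exist a measurable $V:A_0\to[1,+\infty)$, constants $\theta_0\in(0,1]$, $C_Q\in\mathbb R_+$, $\alpha\in(0,1)$, a nonzero measurable $\eta:A_0\to\mathbb R_+$ with $\eta/V$ bounded, and a probability measure $\nu$ on $A_0$ with $\nu(V)<+\infty$ and $\nu(\eta)>0$, such that $$\left|\theta_0^{-kt}Q_kf(x)-\eta(x)\nu(f)\right|\le C_Q\,\alpha^k\,V(x)$$ for all measurable $f$ on $A_0$ with $|f|\le V$, all $k\ge0$ and all $x\in A_0$. *)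

(* Defs.v *)
From HB Require Import structures.
From mathcomp Require Import all_boot all_order all_algebra.
From mathcomp Require Import all_classical all_reals all_analysis.

Set Implicit Arguments.
Unset Strict Implicit.
Unset Printing Implicit Defensive.

Import Order.TTheory GRing.Theory Num.Theory.
Import numFieldNormedType.Exports.

Local Open Scope classical_set_scope.
Local Open Scope ring_scope.

(* The state space E + {cemetery}: [None] is the cemetery point, and a set is
   measurable iff its trace on E is. In particular {None} is measurable. *)
Definition cemetery (E : Type) : Type := option E.

Section cemetery_measurable.
Context d (E : measurableType d).

Definition cemetery_measurable : set (set (cemetery E)) :=
  [set B | measurable (Some @^-1` B : set E)].

Lemma cemetery_measurable0 : cemetery_measurable set0.
Proof. by rewrite /cemetery_measurable /= preimage_set0. Qed.

Lemma cemetery_measurableC B :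
  cemetery_measurable B -> cemetery_measurable (~` B).
Proof.
rewrite /cemetery_measurable /= => mB.
by rewrite preimage_setC; exact: measurableC.
Qed.

Lemma cemetery_measurable_bigcup (F : (set (cemetery E))^nat) :
  (forall i, cemetery_measurable (F i)) ->
  cemetery_measurable (\bigcup_i (F i)).
Proof.
rewrite /cemetery_measurable /= => mF.
by rewrite preimage_bigcup; exact: bigcupT_measurable.
Qed.

HB.instance Definition _ := Pointed.copy (cemetery E) (option E).
HB.instance Definition _ := isMeasurable.Build d (cemetery E)
  cemetery_measurable0 cemetery_measurableC cemetery_measurable_bigcup.

End cemetery_measurable.

Section absorbed_chain.
Context (R : realType) (d dO : measure_display).
Context (E : measurableType d) (Om : measurableType dO).

(* [P x] is the law of the chain started from [x]. *)
Variable P : R.-pker cemetery E ~> Om.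
Variable X : nat -> Om -> cemetery E.

(* The sigma-algebra generated by X_0, ..., X_n. *)
Definition past (n : nat) : set (set Om) :=
  <<s [set D | exists k (B : set (cemetery E)),
         [/\ (k <= n)%N, measurable B & D = X k @^-1` B] ]>>.

(* Singletons of E need not be measurable, so "X_0 = x almost surely" is read
   as: the law of X_0 under P_x is the Dirac mass at x. *)
Record absorbed_markov_chain : Prop := AbsorbedMarkovChain {
  chain_measurable : forall n, measurable_fun setT (X n) ;
  chain_init : forall (x : cemetery E) (B : set (cemetery E)),
    measurable B -> P x (X 0%N @^-1` B) = \d_x B ;
  chain_markov : forall (x : cemetery E) (n : nat) (D : set Om)
      (B : set (cemetery E)), past n D -> measurable B ->
    P x (D `&` X n.+1 @^-1` B) =
    (\int[P x]_(w in D) P (X n w) (X 1%N @^-1` B))%E ;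
  chain_absorbing : P None (X 1%N @^-1` [set None]) = 1%E }.

Definition tau (w : Om) : \bar R :=
  ereal_inf [set n%:R%:E | n in [set n : nat | X n w = None]].

Definition alive (n : nat) : set Om := [set w | (n%:R%:E < tau w)%E].

(* P_n f (x) = E_x (f (X_n) 1_{n < tau}). *)
Definition semigroup (n : nat) (f : E -> R) (x : E) : \bar R :=
  (\int[P (Some x)]_(w in alive n) (oapp f 0%R (X n w))%:E)%E.

(* mu P_n f *)
Definition measure_semigroup (mu : set E -> \bar R) (n : nat) (f : E -> R) :
    \bar R :=
  (\int[mu]_x semigroup n f x)%E.

(* P_mu *)
Definition law (mu : set E -> \bar R) (D : set Om) : \bar R :=
  (\int[mu]_x P (Some x) D)%E.

(* P_mu (X_n \in B | n < tau), with the convention that it is 0 when the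
   conditioning event is null. *)
Definition cond_law (mu : set E -> \bar R) (n : nat) (B : set E) : R :=
  fine (law mu (X n @^-1` (Some @` B) `&` alive n)) / fine (law mu (alive n)).

(* Since pi has mass 1 and [cond_law] is identically 0 when the conditioning
   event is null, this forces P_pi (n < tau) > 0. *)
Definition quasi_stationary (pi : probability E R) : Prop :=
  forall (n : nat) (B : set E), measurable B -> (cond_law pi n B)%:E = pi B.

Definition periodic_partition (t : nat) (A : 'I_t -> set E) : Prop :=
  [/\ trivIset setT A,
      \bigcup_i A i = setT &
      forall (i j : 'I_t) (x : E), A i x ->
        (j <> ordS i -> semigroup 1 \1_(A j) x = 0%E) /\
        (j = ordS i -> semigroup 1 \1_(A j) x = semigroup 1 \1_setT x)].

(* A function on A0 is given by a function on E, of which only the values on A0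
   matter; [f \_ A0] is its extension by 0 (the default point of R). *)
Definition assumption_H (t : nat) (A0 : set E) (V : E -> R)
    (theta0 CQ alpha : R) (eta : E -> R) (nu : probability E R) : Prop :=
  [/\ measurable_fun A0 V /\ (forall x, A0 x -> 1 <= V x),
      [/\ 0 < theta0 <= 1, 0 <= CQ & 0 < alpha < 1],
      [/\ measurable_fun A0 eta, forall x, A0 x -> 0 <= eta x,
          exists2 x, A0 x & eta x <> 0 &
          exists M : R, forall x, A0 x -> eta x / V x <= M],
      [/\ nu A0 = 1%E, (\int[nu]_(x in A0) (V x)%:E < +oo)%E &
          (0 < \int[nu]_(x in A0) (eta x)%:E)%E] &
      forall f : E -> R, measurable_fun A0 f ->
        (forall x, A0 x -> `|f x| <= V x) ->
        forall (k : nat) (x : E), A0 x ->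
        (`| (theta0 ^- (k * t))%:E * semigroup (k * t) (f \_ A0) x
            - (eta x)%:E * \int[nu]_(y in A0) (f y)%:E |
          <= (CQ * alpha ^+ k * V x)%:E)%E].

End absorbed_chain.

Definition tv_dist (R : realType) (d : measure_display) (E : measurableType d)
    (m1 m2 : set E -> R) : \bar R :=
  ereal_sup [set (`|m1 B - m2 B|)%:E | B in measurable].

(* Main.v *)
Require Import Defs.
From HB Require Import structures.
From mathcomp Require Import all_boot all_order all_algebra.
From mathcomp Require Import all_classical all_reals all_analysis.
From mathcomp Require Import measurable_realfun giry.
From mathcomp Require Import ring lra.

Set Implicit Arguments.
Unset Strict Implicit.
Unset Printing Implicit Defensive.

Import Order.TTheory GRing.Theory Num.Theory.
Import numFieldNormedType.Exports.

Local Open Scope classical_set_scope.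
Local Open Scope ring_scope.

(** Write nu_j = theta0^-j nu P_j. Applying (H) to f = P_j 1_B gives
    theta0^-(kt) P_(kt+j) 1_B(x) -> eta(x) nu P_j(B) on A_0, geometrically fast
    and uniformly in B. Comparing the step k+1 for j with the step k for t + j,
    at a point where eta <> 0, gives nu P_(t+j) = theta0^t nu P_j, that is,
    nu_(t+j) = nu_j. From A_i the chain enters A_0 after t - i steps, so that,
    with c_i = theta0^i mu|_(A_i) P_(t-i) eta, uniformly in B,
      theta0^(t-n) mu P_n(B) = L_n(B) + O(alpha^(n/t)),
      L_n = sum_i c_i nu_(n+i),
    and P_mu(X_n in B | n < tau) - L_n(B) / L_n(E) -> 0. If all the c_i are
    equal, L_n is a multiple of nu_0 + ... + nu_(t-1), whose normalization is
    quasi-stationary. Conversely a limit pi satisfies pi(A_l) L_n(E) = L_n(A_l)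
    for all n and l, since L is periodic in n; as nu_j charges only A_(j mod t),
    dividing by nu_l(A_l) and summing over l shows that L_n(E) does not depend
    on n, and then L_(t-i)(A_0) = c_i nu_0(A_0) does not depend on i. *)

(** * Restriction, concentration and binding of measures *)

Section subprobability_restriction.
Context d (T : measurableType d) (R : realType).

(** The bound [m1] is carried as an argument so that the subprobability instance below can use it,
    which makes the restriction a point of [giry T R]. *)
Definition giry_restr (m : {measure set T -> \bar R}) (m1 : (m setT <= 1)%E)
  (D : set T) (mD : measurable D) : set T -> \bar R := mrestr m mD.

Variables (m : {measure set T -> \bar R}) (m1 : (m setT <= 1)%E) (D : set T)
  (mD : measurable D).

HB.instance Definition _ := Measure.copy (giry_restr m1 mD) (mrestr m mD).

Let giry_restr_setT : (giry_restr m1 mD setT <= 1)%E.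
Proof.
rewrite /giry_restr /= /mrestr setTI.
by apply: (le_trans _ m1); apply: le_measure => //; rewrite inE.
Qed.

HB.instance Definition _ :=
  Measure_isSubProbability.Build _ _ _ (giry_restr m1 mD) giry_restr_setT.

End subprobability_restriction.

Section integral_concentrated.
Local Open Scope ereal_scope.
Context d (T : measurableType d) (R : realType).

Lemma ge0_integral_concentrated (m : {measure set T -> \bar R}) (D : set T)
    (f : T -> \bar R) :
  measurable D -> m (~` D) = 0 -> measurable_fun setT f ->
  (forall x, 0 <= f x) -> \int[m]_x f x = \int[m]_(x in D) f x.
Proof.
move=> mD m0 mf f0.
rewrite (@ge0_negligible_integral _ _ _ _ setT (~` D))//;
  last exact: measurableC.
by rewrite setTD setCK.
Qed.

Lemma ge0_integral_mrestr (m : {measure set T -> \bar R}) (D : set T)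
    (mD : measurable D) (f : T -> \bar R) :
  measurable_fun setT f -> (forall x, 0 <= f x) ->
  \int[mrestr m mD]_x f x = \int[m]_(x in D) f x.
Proof.
move=> mf f0; rewrite (ge0_integral_concentrated mD)//; last first.
  by rewrite /= /mrestr setICl measure0.
by apply: eq_measure_integral => B mB BD; rewrite /= /mrestr setIidl.
Qed.

Lemma giry_bindE d' (T' : measurableType d') (m : giry T R)
    (k : T -> giry T' R) (mk : measurable_fun setT k) (B : set T') :
  measurable B -> giry_bind m mk B = \int[m]_x k x B.
Proof.
move=> mB; transitivity (\int[giry_bind m mk]_y (\1_B y)%:E).
  by rewrite integral_indic// setIT.
transitivity (\int[m]_x \int[k x]_y (\1_B y)%:E).
  apply: giry_int_bind; first exact/measurable_EFinP.
  by move=> x; rewrite lee_fin.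
by apply: eq_integral => x _; rewrite integral_indic// setIT.
Qed.

End integral_concentrated.

(** * The transition kernels of the absorbed chain *)

Lemma kernel_setT_le1 d d' (T : measurableType d) (T' : measurableType d')
  (R : realType) (k : R.-pker T ~> T') x : (k x setT <= 1)%E.
Proof. by rewrite prob_kernel. Qed.

Section transition.
Local Open Scope ereal_scope.
Context (R : realType) (d dO : measure_display).
Context (E : measurableType d) (Om : measurableType dO).
Variable P : R.-pker cemetery E ~> Om.
Variable X : nat -> Om -> cemetery E.
Hypothesis chainX : absorbed_markov_chain P X.

Lemma measurable_Some : measurable_fun setT (Some : E -> cemetery E).
Proof. by move=> _ B mB; rewrite setTI. Qed.

Lemma preimage_Some_image (B : set E) : Some @^-1` (Some @` B) = B.
Proof. by apply/seteqP; split=> [x [y By [<-]]//|x Bx]; exists x. Qed.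

Lemma measurable_image_Some (B : set E) :
  measurable B -> measurable (Some @` B : set (cemetery E)).
Proof.
by move=> mB; rewrite /measurable/= /cemetery_measurable/= preimage_Some_image.
Qed.

Lemma measurable_None : measurable ([set None] : set (cemetery E)).
Proof.
rewrite /measurable/= /cemetery_measurable/= (_ : _ @^-1` _ = set0)//.
by apply/seteqP; split.
Qed.

Lemma measurable_position n (B : set (cemetery E)) :
  measurable B -> measurable (X n @^-1` B).
Proof.
by move=> mB; rewrite -[_ @^-1` _]setTI; exact: (chain_measurable chainX).
Qed.

Lemma aliveE n : alive R X n = [set w | forall k, (k <= n)%N -> X k w <> None].
Proof.
apply/seteqP; split=> w /=; rewrite /alive /tau /=.
  move=> /lt_le_trans h k kn Xk.
  have /h : ereal_inf [set m%:R%:E | m in [set m : nat | X m w = None]]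
      <= (k%:R : R)%:E by apply: ereal_inf_lbound; exists k.
  by rewrite lte_fin ltr_nat ltnNge kn.
(* Hitting times are integers larger than n, so their infimum is at least n + 1; this gives the
   strict inequality, also when there are none. *)
move=> h; apply: (@lt_le_trans _ _ ((n.+1%:R : R)%:E)).
  by rewrite lte_fin ltr_nat.
apply: le_ereal_inf_tmp => _ [k /= Xk <-]; rewrite lee_fin ler_nat ltnNge.
by apply/negP => /h.
Qed.

(** This is what allows the Markov property at time n to be used on the event of survival. *)
Lemma past_alive n : past X n (alive R X n).
Proof.
rewrite (_ : alive R X n = ~` \bigcup_k
    (if (k <= n)%N then X k @^-1` [set None] else set0)); last first.
  rewrite aliveE; apply/seteqP; split=> w /=.
    by move=> h [k _]; case: ifPn => // kn /= /(h _ kn).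
  by move=> h k kn Xk; apply: h; exists k => //; rewrite kn.
apply: sigma_algebraC.
apply: sigma_algebra_bigcup => k; case: ifPn => kn; last exact: sigma_algebra0.
apply: sub_sigma_algebra; exists k, [set None]; split => //.
exact: measurable_None.
Qed.

Lemma measurable_alive n : measurable (alive R X n).
Proof.
have := @past_alive n; apply: smallest_sub => //=.
  exact: sigma_algebra_measurable.
by move=> _ [k [B [_ mB ->]]]; exact: measurable_position.
Qed.

Lemma measurable_odflt_position n x :
  measurable_fun setT (fun w => odflt x (X n w)).
Proof.
move=> _ B mB; rewrite setTI.
rewrite (_ : _ @^-1` B = X n @^-1` ((odflt x : cemetery E -> E) @^-1` B))//.
apply: measurable_position.
by rewrite /measurable/= /cemetery_measurable/=; exact: mB.
Qed.

(* The value [x] given to the position at the cemetery is irrelevant, because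
   the law is restricted to the paths still alive at time n. *)
Definition transition n (x : E) : giry E R :=
  giry_map (measurable_odflt_position n x)
    (giry_restr (kernel_setT_le1 P (Some x)) (measurable_alive n)).

Lemma transitionE n x B :
  transition n x B = P (Some x) (X n @^-1` (Some @` B) `&` alive R X n).
Proof.
rewrite /transition/= /giry_map/= /pushforward /giry_restr /mrestr.
congr (P (Some x) _); apply/seteqP; split=> w /= [] => [Bx aw|[y By Xw] aw].
  split=> //; move: aw Bx; rewrite aliveE/= => /(_ n (leqnn n)).
  by case: (X n w) => [y|]//= _ By; exists y.
by split=> //; rewrite -Xw.
Qed.

Lemma measurable_transition n : measurable_fun setT (transition n).
Proof.
apply: measurable_giry_codensity => // B mB.
rewrite (_ : (fun x => _) = (fun y => P y (X n @^-1` (Some @` B) `&` alive R X n))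
    \o (Some : E -> cemetery E)); last by apply/funext=> x; exact: transitionE.
apply: measurableT_comp; last exact: measurable_Some.
apply: measurable_kernel; apply: measurableI; last exact: measurable_alive.
by apply: measurable_position; exact: measurable_image_Some.
Qed.

(** Here [g] is any extension of [f] to the cemetery: on [alive n] the position lies in E, so
    [g None] is never seen. *)
Lemma integral_transition n x (f : E -> \bar R) (g : cemetery E -> \bar R) :
  measurable_fun setT f -> (forall y, 0 <= f y) ->
  (forall y, g (Some y) = f y) ->
  \int[transition n x]_y f y = \int[P (Some x)]_(w in alive R X n) g (X n w).
Proof.
move=> mf f0 fg; rewrite /transition/=.
have := giry_int_map (measurable_odflt_position n x)
  (giry_restr (kernel_setT_le1 P (Some x)) (measurable_alive n)) mf f0.
rewrite /giry_int => ->; rewrite ge0_integral_mrestr//=; last first.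
  by apply: measurableT_comp => //; exact: measurable_odflt_position.
apply: eq_integral => w; rewrite inE aliveE/= => /(_ n (leqnn n)).
by case: (X n w).
Qed.

Lemma semigroupE n x (f : E -> R) :
  measurable_fun setT f -> (forall y, (0 <= f y)%R) ->
  semigroup P X n f x = \int[transition n x]_y (f y)%:E.
Proof.
move=> mf f0; rewrite /semigroup.
by rewrite (integral_transition _ _ (g := fun c => (oapp f 0%R c)%:E))//;
  exact/measurable_EFinP.
Qed.

Lemma measurable_transition_set n B : measurable B ->
  measurable_fun setT (fun x => transition n x B).
Proof.
move=> mB.
exact: measurableT_comp (measurable_giry_ev mB) (measurable_transition n).
Qed.

Lemma measurable_integral_transition n (f : E -> \bar R) :
  measurable_fun setT f -> (forall y, 0 <= f y) ->
  measurable_fun setT (fun x => \int[transition n x]_y f y).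
Proof.
move=> mf f0; apply: measurable_fun_integral_kernel => // U mU.
exact: measurable_transition_set.
Qed.

(** The Markov property at time n, applied to the event [alive n]. *)
Lemma transitionS n x B : measurable B ->
  transition n.+1 x B = \int[transition n x]_y transition 1 y B.
Proof.
move=> mB.
rewrite (integral_transition _ _ (g := fun c => P c (X 1%N @^-1` (Some @` B))))//;
  last 2 first.
- exact: measurable_transition_set.
- move=> y; rewrite transitionE.
  (* Requiring survival up to time 1 removes from {X_1 in B} only paths with X_0 at the cemetery, a
     null event under P_y by the initial condition. *)
  have alive1 : X 1%N @^-1` (Some @` B) `&` alive R X 1 =
      X 1%N @^-1` (Some @` B) `\` X 0%N @^-1` [set None].
    apply/seteqP; split=> w /=; rewrite aliveE/=.
      by move=> [Bw h]; split => //; exact: h.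
    move=> [Bw h]; split => // -[|[|]]// _; case: Bw => z _ <- //.
  rewrite alive1 measureD//; last 3 first.
  + by apply: measurable_position; exact: measurable_image_Some.
  + by apply: measurable_position; exact: measurable_None.
  + apply: le_lt_trans (ltry 1); rewrite -(@prob_kernel _ _ _ _ _ P (Some y)).
    apply: le_measure; rewrite ?inE//.
    by apply: measurable_position; exact: measurable_image_Some.
  rewrite [X in _ - X](_ : _ = 0) ?sube0//.
  apply/eqP; rewrite -measure_le0//.
  have <- : P (Some y) (X 0%N @^-1` [set None]) = 0.
    by rewrite (chain_init chainX _ measurable_None) diracE memNset.
  apply: le_measure; rewrite ?inE//.
  - apply: measurableI; apply: measurable_position; last exact: measurable_None.
    exact: measurable_image_Some.
  - by apply: measurable_position; exact: measurable_None.
- rewrite -(chain_markov chainX (Some x) (@past_alive n) (measurable_image_Some mB)).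
  rewrite transitionE; congr (P (Some x) _); apply/seteqP; split=> w /=.
    by rewrite !aliveE/= => -[Bw h]; split=> // k kn; exact: h (leqW kn).
  rewrite !aliveE/= => -[h Bw]; split=> // k; rewrite leq_eqVlt.
  by case/orP => [/eqP ->|/h//]; case: Bw => z _ <-.
Qed.

Lemma transition0 x B : measurable B -> transition 0 x B = \d_x B.
Proof.
move=> mB; rewrite transitionE.
have -> : X 0%N @^-1` (Some @` B) `&` alive R X 0 = X 0%N @^-1` (Some @` B).
  apply/seteqP; split=> w /=; first by case.
  by move=> Bw; split=> //; rewrite aliveE/= => -[|]// _; case: Bw => z _ <-.
rewrite (chain_init chainX _ (measurable_image_Some mB)) !diracE.
suff -> : (Some x \in Some @` B) = (x \in B) by [].
by apply/idP/idP; rewrite !inE/=; [case=> y By [<-]|move=> Bx; exists x].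
Qed.

(** Chapman-Kolmogorov, by peeling off the last step; [f] varies in the induction because the
    hypothesis is applied to P_1 f. *)
Lemma integral_transitionD m n x (f : E -> \bar R) :
  measurable_fun setT f -> (forall y, 0 <= f y) ->
  \int[transition (m + n) x]_y f y =
  \int[transition m x]_y \int[transition n y]_z f z.
Proof.
move=> + f0; elim: n x f f0 => [|n ih] x f f0 mf.
  rewrite addn0; apply: eq_integral => y _.
  rewrite (eq_measure_integral (dirac y)); last first.
    by move=> B mB _; exact: transition0.
  by rewrite integral_dirac// diracT mul1e.
(* The identity on sets says that the kernel of k + 1 steps is a [giry_bind]; this passes it to
   integrals. *)
have step k z g : measurable_fun setT g -> (forall y, 0 <= g y) ->
    \int[transition k.+1 z]_y g y =
    \int[transition k z]_y \int[transition 1 y]_u g u.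
  move=> mg g0; transitivity
    (\int[giry_bind (transition k z) (measurable_transition 1)]_y g y).
    apply: eq_measure_integral => B mB _.
    exact: etrans (transitionS k z mB) (esym (giry_bindE _ _ mB)).
  exact: giry_int_bind.
have f1 y : 0 <= \int[transition 1 y]_u f u by exact: integral_ge0.
rewrite addnS (step _ _ _ mf f0).
rewrite (ih _ _ f1 (measurable_integral_transition 1 mf f0)).
by apply: eq_integral => y _; rewrite -(step _ _ _ mf f0).
Qed.

Lemma transitionD m n x B : measurable B ->
  transition (m + n) x B = \int[transition m x]_y transition n y B.
Proof.
move=> mB; transitivity (\int[transition (m + n) x]_y (\1_B y)%:E).
  by rewrite integral_indic// setIT.
rewrite integral_transitionD; last 2 first.
- exact/measurable_EFinP.
- by move=> y; rewrite lee_fin.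
by apply: eq_integral => y _; rewrite integral_indic// setIT.
Qed.

Lemma transition_le1 n x B : measurable B -> transition n x B <= 1.
Proof.
move=> mB; apply: (le_trans _ (@sprobability_setT _ _ _ (transition n x))).
by apply: le_measure; rewrite ?inE.
Qed.

Lemma transition_alive_decr n x :
  transition n.+1 x setT <= transition n x setT.
Proof.
rewrite transitionS//; apply: (@le_trans _ _ (\int[transition n x]_y cst 1 y)).
  by apply: ge0_le_integral => //; [exact: measurable_transition_set|
    move=> y _; exact: transition_le1].
by rewrite integral_cst// mul1e.
Qed.

End transition.

(** * Comparison of integrals, and masses m P_n(B) *)

Section integral_bounds.
Local Open Scope ereal_scope.
Context d (T : measurableType d) (R : realType).

Lemma ge0_integral_restrict_concentrated (m : {measure set T -> \bar R})
    (D : set T) (f : T -> R) :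
  measurable D -> m (~` D) = 0 -> measurable_fun setT f ->
  (forall x, (0 <= f x)%R) -> \int[m]_x ((f \_ D) x)%:E = \int[m]_x (f x)%:E.
Proof.
move=> mD m0 mf f0.
have mf' : measurable_fun setT (EFin \o f) by exact/measurable_EFinP.
rewrite [RHS](ge0_integral_concentrated mD m0)//.
rewrite [RHS]integral_mkcond; apply: eq_integral => x _.
by rewrite !patchE/=; case: ifPn.
Qed.

(** Integrating f <= g + h and g <= f + h gives both sides of the estimate without integrating the
    signed function f - g. *)
Lemma fine_integral_dist (m : {measure set T -> \bar R}) (f g h : T -> R) :
  measurable_fun setT f -> measurable_fun setT g -> measurable_fun setT h ->
  (forall x, (0 <= f x)%R) -> (forall x, (0 <= g x)%R) ->
  (forall x, (`|f x - g x| <= h x)%R) ->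
  \int[m]_x (f x)%:E < +oo -> \int[m]_x (g x)%:E < +oo ->
  \int[m]_x (h x)%:E < +oo ->
  (`|fine (\int[m]_x (f x)%:E) - fine (\int[m]_x (g x)%:E)|
    <= fine (\int[m]_x (h x)%:E))%R.
Proof.
move=> mf mg mh f0 g0 fgh If Ig Ih.
have h0 x : (0 <= h x)%R by rewrite (le_trans _ (fgh x)).
have key (u v : T -> R) : measurable_fun setT u -> measurable_fun setT v ->
    (forall x, (0 <= u x)%R) -> (forall x, (0 <= v x)%R) ->
    (forall x, (u x <= v x + h x)%R) ->
    \int[m]_x (u x)%:E <= \int[m]_x (v x)%:E + \int[m]_x (h x)%:E.
  move=> mu mv u0 v0 uvh; rewrite -ge0_integralD//; last 4 first.
  - by move=> x _; rewrite lee_fin.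
  - exact/measurable_EFinP.
  - by move=> x _; rewrite lee_fin.
  - exact/measurable_EFinP.
  apply: ge0_le_integral => //.
  - by move=> x _; rewrite lee_fin.
  - exact/measurable_EFinP.
  - by apply: emeasurable_funD; exact/measurable_EFinP.
  - by move=> x _; rewrite -EFinD lee_fin.
have fin (w : T -> R) : (forall x, (0 <= w x)%R) ->
    \int[m]_x (w x)%:E < +oo -> (\int[m]_x (w x)%:E) \is a fin_num.
  move=> w0; rewrite ge0_fin_numE//.
  by apply: integral_ge0 => x _; rewrite lee_fin.
move: (key f g mf mg f0 g0) (key g f mg mf g0 f0).
rewrite -(fineK (fin _ f0 If)) -(fineK (fin _ g0 Ig)) -(fineK (fin _ h0 Ih)).
rewrite -!EFinD !lee_fin !fineK ?fin// => h2 h1.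
rewrite ler_distl; apply/andP; split.
  rewrite lerBlDr; apply: h1 => x; have := fgh x; rewrite ler_distl; lra.
apply: h2 => x; have := fgh x; rewrite ler_distl; lra.
Qed.

Lemma integral_giry_01 (m : giry T R) (f : T -> \bar R) :
  measurable_fun setT f -> (forall x, 0 <= f x <= 1) ->
  0 <= \int[m]_x f x <= 1.
Proof.
move=> mf f01; apply/andP; split.
  by apply: integral_ge0 => x _; have /andP[] := f01 x.
apply: (@le_trans _ _ (\int[m]_x cst 1 x)).
  apply: ge0_le_integral => //; first by move=> x _; have /andP[] := f01 x.
  by move=> x _; have /andP[] := f01 x.
by rewrite integral_cst// mul1e; exact: sprobability_setT.
Qed.

End integral_bounds.

Section transition_mass.
Local Open Scope ereal_scope.
Context (R : realType) (d dO : measure_display).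
Context (E : measurableType d) (Om : measurableType dO).
Variable P : R.-pker cemetery E ~> Om.
Variable X : nat -> Om -> cemetery E.
Hypothesis chainX : absorbed_markov_chain P X.

Local Notation K := (transition chainX).

(* m P_n (B) *)
Definition mass (m : set E -> \bar R) n B : R := fine (\int[m]_x K n x B).

Lemma transition_fin n x B : measurable B -> K n x B \is a fin_num.
Proof.
move=> mB; rewrite ge0_fin_numE//.
by apply: le_lt_trans (ltry 1); exact: transition_le1.
Qed.

(** For a subprobability the integral lies in [0, 1], so [fine] loses nothing. *)
Lemma mass_int (m : giry E R) n B : measurable B ->
  \int[m]_x K n x B = (mass m n B)%:E.
Proof.
move=> mB; have /andP[h0 h1] : 0 <= \int[m]_x K n x B <= 1.
  apply: integral_giry_01; first exact: measurable_transition_set.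
  by move=> x; rewrite measure_ge0/= transition_le1.
by rewrite /mass fineK// ge0_fin_numE// (le_lt_trans h1)// ltry.
Qed.

Lemma mass_ge0 (m : giry E R) n B : (0 <= mass m n B)%R.
Proof. by apply: fine_ge0; apply: integral_ge0 => x _. Qed.

Lemma mass_le (m : giry E R) n B C : measurable B -> measurable C ->
  B `<=` C -> (mass m n B <= mass m n C)%R.
Proof.
move=> mB mC BC; rewrite -lee_fin -!mass_int//; apply: ge0_le_integral => //.
- exact: measurable_transition_set.
- exact: measurable_transition_set.
- by move=> x _; apply: le_measure; rewrite ?inE.
Qed.

Lemma mass_setT_decr (m : giry E R) n k :
  (mass m (n + k) setT <= mass m n setT)%R.
Proof.
elim: k => [|k ih]; first by rewrite addn0.
apply: le_trans ih; rewrite addnS -lee_fin -!mass_int//.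
apply: ge0_le_integral => //.
- exact: measurable_transition_set.
- exact: measurable_transition_set.
- by move=> x _; exact: transition_alive_decr.
Qed.

(** Chapman-Kolmogorov for initial measures: the chain may be restarted from its law after k
    steps. *)
Lemma mass_bind (m : giry E R) k n B : measurable B ->
  mass (giry_bind m (measurable_transition chainX k)) n B = mass m (k + n) B.
Proof.
move=> mB; apply: EFin_inj; rewrite -!mass_int//.
transitivity (\int[m]_x \int[K k x]_y K n y B).
  by apply: giry_int_bind => //; exact: measurable_transition_set.
by apply: eq_integral => x _; rewrite transitionD.
Qed.

(** A path alive at time n has its position in E, so the conditioning event is the event of the
    numerator with B = E. *)
Lemma cond_lawE (m : set E -> \bar R) n B :
  cond_law P X m n B = (mass m n B / mass m n setT)%R.
Proof.
rewrite /cond_law /law /mass; congr (fine _ / fine _)%R.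
  by congr (integral m setT _); apply/funext => x; rewrite transitionE.
congr (integral m setT _); apply/funext => x; rewrite transitionE.
congr (P (Some x) _).
apply/seteqP; split=> w /=; last by case.
move=> aw; split=> //; move: aw; rewrite aliveE/= => /(_ n (leqnn n)).
by case: (X n w) => // y _; exists y.
Qed.

Lemma measure_semigroupE (m : {measure set E -> \bar R}) n (f : E -> R) :
  measurable_fun setT f -> (forall x, (0 <= f x)%R) ->
  measure_semigroup P X m n f = \int[m]_x \int[K n x]_y (f y)%:E.
Proof.
by move=> mf f0; apply: eq_integral => x _; exact: semigroupE.
Qed.

End transition_mass.

(** * Periodicity and asymptotics from A_0 *)

Section periodic.
Local Open Scope ereal_scope.
Context (R : realType) (d dO : measure_display).
Context (E : measurableType d) (Om : measurableType dO).
Variable P : R.-pker cemetery E ~> Om.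
Variable X : nat -> Om -> cemetery E.
Hypothesis chainX : absorbed_markov_chain P X.
Variables (t : nat) (A : 'I_t -> set E).
Hypothesis mA : forall i, measurable (A i).
Hypothesis perA : periodic_partition P X A.

Local Notation K := (transition chainX).

(** Periodicity gives the next class the whole one-step mass, which is finite and can be
    subtracted. *)
Lemma transition1_concentrated (i : 'I_t) x : A i x ->
  K 1 x (~` A (ordS i)) = 0.
Proof.
move=> Ax; have [_ _ /(_ i (ordS i) x Ax)[_ /(_ erefl)]] := perA.
rewrite !(semigroupE chainX)// !integral_indic// !setIT => h.
have -> : K 1 x (~` A (ordS i)) = K 1 x setT - K 1 x (A (ordS i)).
  rewrite -setTD measureD//; first by rewrite setTI.
  by rewrite (le_lt_trans _ (ltry 1))//; exact: transition_le1.
by rewrite h subee// transition_fin.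
Qed.

(** The class advances by one at each step; the induction peels off the first step, so the starting
    class varies. *)
Lemma transition_concentrated n (i j : 'I_t) x : A i x ->
  ((i + n) %% t)%N = j -> K n x (~` A j) = 0.
Proof.
elim: n i x => [|n ih] i x Ax ij.
  rewrite transition0; last exact: measurableC.
  rewrite diracE memNset//= => /(_ _).
  suff -> : j = i by [].
  by apply: val_inj; rewrite /= -ij addn0 modn_small.
rewrite -add1n transitionD; last exact: measurableC.
rewrite (ge0_integral_concentrated (mA (ordS i)))//; last 2 first.
- exact: transition1_concentrated.
- by apply: measurable_transition_set; exact: measurableC.
apply: integral0_eq => y Ay; apply: (ih (ordS i)) => //.
by rewrite /= modnDml addSnnS.
Qed.

End periodic.

Section asymptotics.
Local Open Scope ereal_scope.
Context (R : realType) (d dO : measure_display).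
Context (E : measurableType d) (Om : measurableType dO).
Variable P : R.-pker cemetery E ~> Om.
Variable X : nat -> Om -> cemetery E.
Hypothesis chainX : absorbed_markov_chain P X.
Variables (t : nat) (t_gt0 : (0 < t)%N) (A : 'I_t -> set E).
Hypothesis mA : forall i, measurable (A i).
Hypothesis perA : periodic_partition P X A.
Local Notation A0 := (A (Ordinal t_gt0)).
Variables (V : E -> R) (theta0 CQ alpha : R) (eta : E -> R).
Variable nu : probability E R.
Hypothesis hypH : assumption_H P X t A0 V theta0 CQ alpha eta nu.

Local Notation K := (transition chainX).

Lemma nu_concentrated : nu (~` A0) = 0.
Proof.
have [_ _ _ [nu1 _ _] _] := hypH.
by rewrite probability_setC// nu1 subee.
Qed.

Lemma transition_return k x : A0 x -> K (k * t) x (~` A0) = 0.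
Proof.
move=> Ax; apply: (transition_concentrated _ mA perA Ax).
by rewrite add0n modnMl.
Qed.

(** (H) applies to P_j 1_B because this function is at most 1, hence at most V on A_0. *)
Lemma transition_asymptotics k j x B : measurable B -> A0 x ->
  (`|theta0 ^- (k * t) * fine (K (k * t + j) x B) - eta x * mass chainX nu j B|
    <= CQ * alpha ^+ k * V x)%R.
Proof.
move=> mB Ax; have [[mV V1] _ _ _ Hf] := hypH.
pose f y := fine (K j y B).
have mf : measurable_fun setT f.
  apply: measurableT_comp (measurable_transition_set _ _ mB) => //.
have f0 y : (0 <= f y)%R by exact: fine_ge0.
have fK y : (f y)%:E = K j y B by rewrite fineK// transition_fin.
have fV y : A0 y -> (`|f y| <= V y)%R.
  move=> Ay; rewrite ger0_norm// (le_trans _ (V1 y Ay))// -lee_fin fK.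
  exact: transition_le1.
have := Hf f (measurable_funTS mf) fV k x Ax.
rewrite (semigroupE chainX); last 2 first.
- exact/(measurable_restrictT _ (mA _)).1/measurable_funTS.
- by move=> y; rewrite patchE; case: ifPn.
(* Cutting [f] to A_0 changes nothing, since after kt steps from A_0 the surviving chain is again in
   A_0. *)
rewrite (ge0_integral_restrict_concentrated (mA _) (transition_return k Ax))//.
rewrite (eq_integral (fun y => K j y B))//.
rewrite -transitionD//.
rewrite -(ge0_integral_concentrated (mA _) nu_concentrated); last 2 first.
- exact/measurable_EFinP.
- by move=> y; rewrite lee_fin.
rewrite (eq_integral (fun y => K j y B))//.
rewrite (mass_int chainX nu)// -(fineK (transition_fin chainX _ x mB)).
by rewrite -!EFinM -EFinB abse_EFin lee_fin.
Qed.

End asymptotics.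

(** * Elementary estimates and periodic sequences *)

(** Writing the difference as ((x / y) (b - y) + (x - a)) / b, with x / y in [0, 1], leaves only b
    in the denominator. If y = 0 then x = 0 and x / y = 0 by convention, which matches the
    convention of [cond_law]. *)
Lemma ratio_dist (R : realFieldType) (x y a b e : R) :
  0 <= x <= y -> 0 < b -> `|x - a| <= e -> `|y - b| <= e ->
  `|x / y - a / b| <= 2 * e / b.
Proof.
move=> /andP[x0 xy] b0 xa yb.
have [xy0 xy1] : 0 <= x / y /\ x / y <= 1.
  split; first by rewrite divr_ge0// (le_trans x0).
  have [y0|y0] := eqVneq y 0; first by rewrite y0 invr0 mulr0.
  by rewrite ler_pdivrMr ?mul1r// lt_neqAle eq_sym y0 (le_trans x0).
have -> : x / y - a / b = (x / y * (b - y) + (x - a)) / b.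
  have [y0|y0] := eqVneq y 0; last by field; rewrite y0 gt_eqF.
  have -> : x = 0 by apply/eqP; rewrite eq_le x0 -y0 xy.
  by rewrite y0 !mul0r !add0r -mulNr.
rewrite normrM normfV (gtr0_norm b0) ler_pM2r ?invr_gt0//.
apply: (le_trans (ler_normD _ _)).
rewrite (_ : 2 * e = 1 * e + e); last by ring.
apply: lerD => //; rewrite normrM ger0_norm//.
by apply: ler_pM => //; rewrite distrC.
Qed.

Lemma geometric_bound_eq0 (R : realType) (a D alpha : R) : 0 < alpha < 1 ->
  (forall k, `|a| <= D * alpha ^+ k) -> a = 0.
Proof.
move=> /andP[al0 al1] aD; apply/eqP; rewrite -normr_eq0 eq_le normr_ge0 andbT.
have Da : geometric D alpha k @[k --> \oo] --> (0 : R).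
  by apply: cvg_geometric; rewrite gtr0_norm.
have /cvg_lim <- // := Da.
apply: limr_ge; first by apply/cvg_ex; exists 0.
by apply: nearW => k; exact: aD.
Qed.

Lemma periodic_modn (T : Type) (v : nat -> T) t n :
  (forall j, v (t + j)%N = v j) -> v n = v (n %% t)%N.
Proof.
move=> vt; rewrite {1}(divn_eq n t).
by elim: (n %/ t)%N => [|q ih]; rewrite ?mul0n ?add0n// mulSn -addnA vt.
Qed.

(** Moving the window by one trades v(n) for the equal term v(n + t); both sums are compared with
    the sum of t + 1 terms. *)
Lemma sum_periodic (V : zmodType) (v : nat -> V) t n :
  (forall j, v (t + j)%N = v j) -> \sum_(i < t) v (n + i)%N = \sum_(i < t) v i.
Proof.
move=> vt; elim: n => [|n ih]; first by apply: eq_bigr.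
rewrite -ih; apply: (addrI (v n)).
have : v n + \sum_(i < t) v (n.+1 + i)%N = \sum_(i < t.+1) v (n + i)%N.
  rewrite big_ord_recl addn0; congr (_ + _).
  by apply: eq_bigr => i _; rewrite lift0 addnS addSn.
by move=> ->; rewrite big_ord_recr /= [(n + t)%N]addnC vt addrC.
Qed.

(** * The measures nu_j, and asymptotics from an initial measure on A_0 *)

Section limits.
Local Open Scope ereal_scope.
Context (R : realType) (d dO : measure_display).
Context (E : measurableType d) (Om : measurableType dO).
Variable P : R.-pker cemetery E ~> Om.
Variable X : nat -> Om -> cemetery E.
Hypothesis chainX : absorbed_markov_chain P X.
Variables (t : nat) (t_gt0 : (0 < t)%N) (A : 'I_t -> set E).
Hypothesis mA : forall i, measurable (A i).
Hypothesis perA : periodic_partition P X A.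
Local Notation A0 := (A (Ordinal t_gt0)).
Variables (V : E -> R) (theta0 CQ alpha : R) (eta : E -> R).
Variable nu : probability E R.
Hypothesis hypH : assumption_H P X t A0 V theta0 CQ alpha eta nu.

Local Notation K := (transition chainX).
Local Notation N := (mass chainX nu).

Lemma theta0_gt0 : (0 < theta0)%R.
Proof. by have [_ [/andP[]]] := hypH. Qed.

Lemma theta0_le1 : (theta0 <= 1)%R.
Proof. by have [_ [/andP[]]] := hypH. Qed.

Lemma alpha_itv : (0 < alpha < 1)%R.
Proof. by have [_ []] := hypH. Qed.

Lemma eta_restrict_ge0 x : (0 <= (eta \_ A0) x)%R.
Proof.
have [_ _ [_ eta0 _ _] _ _] := hypH.
by rewrite patchE; case: ifPn => //; rewrite inE => /eta0.
Qed.

Lemma V_restrict_ge0 x : (0 <= (V \_ A0) x)%R.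
Proof.
have [[_ V1] _ _ _ _] := hypH.
by rewrite patchE; case: ifPn => //; rewrite inE => /V1; exact: le_trans.
Qed.

Lemma measurable_eta_restrict : measurable_fun setT (eta \_ A0).
Proof.
by have [_ _ [me _ _ _] _ _] := hypH; apply/(measurable_restrictT _ (mA _)).
Qed.

Lemma measurable_V_restrict : measurable_fun setT (V \_ A0).
Proof.
by have [[mV _] _ _ _ _] := hypH; apply/(measurable_restrictT _ (mA _)).
Qed.

Lemma eta_le_V : exists2 M : R, (0 <= M)%R &
  forall x, ((eta \_ A0) x <= M * (V \_ A0) x)%R.
Proof.
have [[_ V1] _ [_ _ _ [M HM]] _ _] := hypH.
exists (Num.max M 0)%R; first by rewrite le_max lexx orbT.
move=> x; rewrite !patchE; case: ifPn; last by rewrite mulr0.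
rewrite inE => Ax; have V0 : (0 < V x)%R by rewrite (lt_le_trans _ (V1 x Ax)).
by rewrite -ler_pdivrMr// le_max HM.
Qed.

Lemma mass_nu_period j B : measurable B ->
  (N (t + j) B = theta0 ^+ t * N j B)%R.
Proof.
move=> mB; have [_ _ [_ _ [x Ax etax] _] _ _] := hypH.
have th0 := theta0_gt0.
have tn0 n : (theta0 ^+ n != 0)%R by rewrite expf_neq0// gt_eqF.
have key k := transition_asymptotics chainX mA perA hypH k j mB Ax.
have key' k := transition_asymptotics chainX mA perA hypH k (t + j) mB Ax.
suff /eqP : (eta x * (N (t + j) B - theta0 ^+ t * N j B) = 0)%R.
  by rewrite mulf_eq0 subr_eq0 => /orP[/eqP//|/eqP].
(* The time (k + 1)t + j = kt + (t + j) is estimated twice; D adds the error at k and theta0^t times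
   the error at k + 1. *)
pose D : R := (CQ * V x * (1 + theta0 ^+ t * alpha))%R.
apply: (geometric_bound_eq0 (D := D) alpha_itv) => k.
move: (key k.+1) (key' k); rewrite addnA -mulSnr.
set p := fine _; set a := N j B; set b := N (t + j) B => h1 h2.
have -> : (eta x * (b - theta0 ^+ t * a) =
  theta0 ^+ t * (theta0 ^- (k.+1 * t) * p - eta x * a)
  - (theta0 ^- (k * t) * p - eta x * b))%R.
  by rewrite mulSn exprD; field; rewrite !tn0.
apply: (le_trans (ler_normB _ _)).
have -> : (D * alpha ^+ k = theta0 ^+ t * (CQ * alpha ^+ k.+1 * V x)
                           + CQ * alpha ^+ k * V x)%R.
  by rewrite /D exprS; ring.
apply: lerD => //; rewrite normrM (ger0_norm (ltW (exprn_gt0 _ th0))).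
by rewrite ler_pM2l// exprn_gt0.
Qed.

Lemma mass_nu0 : N 0 setT = 1%R.
Proof.
apply: EFin_inj; rewrite -mass_int// (eq_integral (cst 1)).
  by rewrite integral_cst// mul1e; exact: probability_setT.
by move=> x _; rewrite transition0// diracT.
Qed.

(* Periodic in j, of period t, because nu Q_1 = theta0^t nu. *)
Definition limit_mass j B : R := (theta0 ^- j * N j B)%R.
Local Notation w := limit_mass.

Lemma limit_massDt j B : measurable B -> w (t + j) B = w j B.
Proof.
move=> mB; rewrite /limit_mass mass_nu_period// exprD.
have tn0 n : (theta0 ^+ n != 0)%R by rewrite expf_neq0// gt_eqF// theta0_gt0.
by field; rewrite !tn0.
Qed.

Lemma limit_mass_mod j B : measurable B -> w j B = w (j %% t) B.
Proof.
by move=> mB; apply: (periodic_modn (v := w ^~ B)) => k; exact: limit_massDt.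
Qed.

(** Reduce to j < t: survival decreases, so nu P_j(E) >= nu P_t(E) = theta0^t, and theta0^-j >=
    1. *)
Lemma limit_mass_setT_ge j : (theta0 ^+ t <= w j setT)%R.
Proof.
rewrite limit_mass_mod//; have jt : (j %% t < t)%N by rewrite ltn_mod.
have th0 := theta0_gt0.
have <- : N t setT = (theta0 ^+ t)%R.
  by have := mass_nu_period 0 measurableT; rewrite addn0 mass_nu0 mulr1.
apply: (@le_trans _ _ (N (j %% t) setT)).
  by rewrite -{1}(subnKC (ltnW jt)); exact: mass_setT_decr.
rewrite /limit_mass ler_peMl ?mass_ge0// invf_ge1 ?exprn_gt0//.
by apply: exprn_ile1; [exact: ltW|exact: theta0_le1].
Qed.

(** As nu lives on A_0, j steps carry it into the class j mod t, and the classes are disjoint. *)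
Lemma limit_mass_class j (l : 'I_t) :
  w j (A l) = if (j %% t == l)%N then w j setT else 0%R.
Proof.
have jt : (j %% t < t)%N by rewrite ltn_mod.
pose jj := Ordinal jt.
have null : forall x, A0 x -> K j x (~` A jj) = 0.
  by move=> x Ax; apply: (transition_concentrated _ mA perA Ax); rewrite add0n.
have eq1 B : measurable B -> (N j B)%:E = \int[nu]_(x in A0) K j x B.
  move=> mB; rewrite -mass_int//; apply: ge0_integral_concentrated => //.
  - exact: nu_concentrated hypH.
  - exact: measurable_transition_set.
case: ifPn => jl.
  have -> : l = jj by apply: val_inj; apply/esym/eqP.
  congr (_ * _)%R; apply: EFin_inj; rewrite !eq1//.
  apply: eq_integral => x; rewrite inE => Ax.
  have <- : A jj `|` ~` A jj = setT by rewrite setUv.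
  rewrite measureU ?setICr//; last exact: measurableC.
  by rewrite -[LHS]adde0; congr (_ + _); exact/esym/null.
rewrite /limit_mass (_ : N j (A l) = 0%R) ?mulr0//.
apply: EFin_inj; rewrite eq1//; apply: integral0_eq => x Ax.
apply/eqP; rewrite -measure_le0 -(null x Ax); apply: le_measure; rewrite ?inE//.
  exact: measurableC.
move=> y Ay Ayj; have [tA _ _] := perA.
have /(congr1 val)/= h := tA l jj I I (ex_intro _ y (conj Ay Ayj)).
by rewrite h eqxx in jl.
Qed.

Lemma integral_V_fin (m : {measure set E -> \bar R}) :
  \int[m]_x ((V \_ A0) x)%:E < +oo ->
  (\int[m]_x ((V \_ A0) x)%:E) \is a fin_num.
Proof.
move=> mV; rewrite ge0_fin_numE//; apply: integral_ge0 => x _.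
by rewrite lee_fin; exact: V_restrict_ge0.
Qed.

Lemma integral_eta_fin (m : {measure set E -> \bar R}) :
  \int[m]_x ((V \_ A0) x)%:E < +oo ->
  (\int[m]_x ((eta \_ A0) x)%:E) \is a fin_num.
Proof.
move=> mVy; have [M M0 eM] := eta_le_V.
have mV := measurable_V_restrict; have me := measurable_eta_restrict.
have V0 := V_restrict_ge0; have e0 := eta_restrict_ge0.
rewrite ge0_fin_numE; last by apply: integral_ge0 => x _; rewrite lee_fin.
apply: (@le_lt_trans _ _ (\int[m]_x (M%:E * ((V \_ A0) x)%:E))).
  apply: ge0_le_integral => //.
  - by move=> x _; rewrite lee_fin.
  - exact/measurable_EFinP.
  - by apply: measurable_funeM; exact/measurable_EFinP.
  - by move=> x _; rewrite -EFinM lee_fin.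
rewrite ge0_integralZl//; last 2 first.
- exact/measurable_EFinP.
- by move=> x _; rewrite lee_fin.
by rewrite -(fineK (integral_V_fin mVy)) -EFinM ltry.
Qed.

(** The pointwise estimate on A_0 is integrated against [rho]. *)
Lemma mass_asymptotics (rho : giry E R) k j B : measurable B ->
  rho (~` A0) = 0 -> \int[rho]_x ((V \_ A0) x)%:E < +oo ->
  (`|theta0 ^- (k * t) * mass chainX rho (k * t + j) B
     - fine (\int[rho]_x ((eta \_ A0) x)%:E) * N j B|
   <= CQ * alpha ^+ k * fine (\int[rho]_x ((V \_ A0) x)%:E))%R.
Proof.
move=> mB rho0 rhoV; have [_ [_ CQ0 _] _ _ _] := hypH.
have /andP[al0 _] := alpha_itv; have th0 := theta0_gt0.
have mV := measurable_V_restrict; have me := measurable_eta_restrict.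
have V0 := V_restrict_ge0; have e0 := eta_restrict_ge0.
have fV := integral_V_fin rhoV; have fe := integral_eta_fin rhoV.
pose u x := (theta0 ^- (k * t) * fine (K (k * t + j) x B))%R.
pose g x := (N j B * (eta \_ A0) x)%R.
pose h x := (CQ * alpha ^+ k * (V \_ A0) x)%R.
have c0 : (0 <= CQ * alpha ^+ k)%R by rewrite mulr_ge0// exprn_ge0// ltW.
have N0 : (0 <= N j B)%R by exact: mass_ge0.
have t0 : (0 <= theta0 ^- (k * t))%R by rewrite invr_ge0 exprn_ge0// ltW.
have mK : measurable_fun setT (fun x => fine (K (k * t + j) x B)).
  by apply: measurableT_comp (measurable_transition_set _ _ mB).
(* The estimate is known on A_0 only, so [u] is cut there; [g] and [h] vanish elsewhere, and [rho]
   does not charge the complement. *)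
have Iu : \int[rho]_x ((u \_ A0) x)%:E
    = (theta0 ^- (k * t) * mass chainX rho (k * t + j) B)%:E.
  rewrite (ge0_integral_restrict_concentrated (mA _) rho0); last 2 first.
  - exact: measurable_funM.
  - by move=> x; rewrite mulr_ge0// fine_ge0.
  under eq_integral do rewrite EFinM.
  rewrite ge0_integralZl//; last 2 first.
  - exact/measurable_EFinP.
  - by move=> x _; rewrite lee_fin fine_ge0.
  rewrite EFinM -mass_int//; congr (_ * _); apply: eq_integral => x _.
  by rewrite fineK// transition_fin.
have Ig : \int[rho]_x (g x)%:E
    = (fine (\int[rho]_x ((eta \_ A0) x)%:E) * N j B)%:E.
  under eq_integral do rewrite EFinM.
  rewrite ge0_integralZl//; last 2 first.
  - exact/measurable_EFinP.
  - by move=> x _; rewrite lee_fin.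
  by rewrite EFinM (fineK fe) muleC.
have Ih : \int[rho]_x (h x)%:E
    = (CQ * alpha ^+ k * fine (\int[rho]_x ((V \_ A0) x)%:E))%:E.
  under eq_integral do rewrite EFinM.
  rewrite ge0_integralZl//; last 2 first.
  - exact/measurable_EFinP.
  - by move=> x _; rewrite lee_fin.
  by rewrite [RHS]EFinM (fineK fV).
have := @fine_integral_dist _ _ _ rho (u \_ A0) g h.
rewrite Iu Ig Ih /=; apply; rewrite ?ltry//.
- apply/(measurable_restrictT _ (mA _)); apply: measurable_funTS.
  exact: measurable_funM.
- exact: measurable_funM.
- exact: measurable_funM.
- by move=> x; rewrite patchE; case: ifPn => // _; rewrite mulr_ge0// fine_ge0.
- by move=> x; rewrite mulr_ge0.
- move=> x; rewrite /g /h !patchE; case: ifPn => [|_].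
    rewrite inE => Ax; rewrite [(N j B * _)%R]mulrC.
    exact: transition_asymptotics.
  by rewrite !mulr0 subrr normr0.
Qed.

End limits.

(** * Asymptotics of the conditional laws *)

Lemma probability_setT_le1 d (T : measurableType d) (R : realType)
  (m : probability T R) : (m setT <= 1)%E.
Proof. by rewrite probability_setT. Qed.

Lemma bigsetU_ord d (T : measurableType d) t (A : 'I_t -> set T) :
  \big[setU/set0]_(i < t) A i = \bigcup_i A i.
Proof.
rewrite -bigcup_seq; apply/seteqP; split=> x [i _ Ax]; exists i => //=.
by rewrite mem_index_enum.
Qed.

Section conditional_limits.
Local Open Scope ereal_scope.
Context (R : realType) (d dO : measure_display).
Context (E : measurableType d) (Om : measurableType dO).
Variable P : R.-pker cemetery E ~> Om.
Variable X : nat -> Om -> cemetery E.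
Hypothesis chainX : absorbed_markov_chain P X.
Variables (t : nat) (t_gt0 : (0 < t)%N) (A : 'I_t -> set E).
Hypothesis mA : forall i, measurable (A i).
Hypothesis perA : periodic_partition P X A.
Local Notation A0 := (A (Ordinal t_gt0)).
Variables (V : E -> R) (theta0 CQ alpha : R) (eta : E -> R).
Variable nu : probability E R.
Hypothesis hypH : assumption_H P X t A0 V theta0 CQ alpha eta nu.
Variable mu : probability E R.

Local Notation K := (transition chainX).
Local Notation N := (mass chainX nu).
Local Notation w := (limit_mass chainX theta0 nu).

Definition class_part (i : 'I_t) : giry E R :=
  giry_restr (probability_setT_le1 mu) (mA i).

(* mu|_{A_i} P_{t-i} *)
Definition entry (i : 'I_t) : giry E R :=
  giry_bind (class_part i) (measurable_transition chainX (t - i)).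

Lemma integral_class_part i (f : E -> \bar R) :
  measurable_fun setT f -> (forall x, 0 <= f x) ->
  \int[class_part i]_x f x = \int[mu]_(x in A i) f x.
Proof. exact: ge0_integral_mrestr. Qed.

Lemma measure_semigroup_entry i (f : E -> R) :
  measurable_fun setT f -> (forall x, (0 <= f x)%R) ->
  measure_semigroup P X (mrestr mu (mA i)) (t - i) f = \int[entry i]_x (f x)%:E.
Proof.
move=> mf f0; rewrite (measure_semigroupE chainX)//.
apply/esym/giry_int_bind; first exact/measurable_EFinP.
by move=> x; rewrite lee_fin.
Qed.

(** From A_i, t - i steps lead to the class t mod t = 0; for i = 0 this is a full turn. *)
Lemma entry_concentrated i : entry i (~` A0) = 0.
Proof.
have mA0 : measurable (~` A0) by exact: measurableC.
apply: etrans (giry_bindE _ _ mA0) _.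
rewrite integral_class_part//; last exact: measurable_transition_set.
apply: integral0_eq => x Ax; apply: (transition_concentrated _ mA perA Ax).
by rewrite subnKC ?modnn// ltnW.
Qed.

Lemma mass_class_part n B : measurable B ->
  mass chainX mu n B = (\sum_(i < t) mass chainX (class_part i) n B)%R.
Proof.
move=> mB; apply: EFin_inj; rewrite -mass_int// -sumEFin.
have [tA UA _] := perA.
rewrite -UA -bigsetU_ord ge0_integral_bigsetU//=.
- apply: eq_bigr => i _; rewrite -mass_int// integral_class_part//.
  exact: measurable_transition_set.
- exact: index_enum_uniq.
- exact: sub_trivIset tA.
- by apply: measurable_funTS; exact: measurable_transition_set.
- by move=> x _; exact: (measure_ge0 (K n x)).
Qed.

Hypothesis entry_V : forall i, \int[entry i]_x ((V \_ A0) x)%:E < +oo.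
Hypothesis entry_eta : 0 < \sum_(i < t) \int[entry i]_x ((eta \_ A0) x)%:E.

(** The constant c_i, taken as a real number. *)
Definition weight (i : 'I_t) : R :=
  (theta0 ^+ i * fine (\int[entry i]_x ((eta \_ A0) x)%:E))%R.

Definition limit_sum n B : R := (\sum_(i < t) weight i * w (n + i) B)%R.
Local Notation L := limit_sum.

Lemma fine_entry_eta_ge0 i : (0 <= fine (\int[entry i]_x ((eta \_ A0) x)%:E))%R.
Proof.
apply: fine_ge0; apply: integral_ge0 => x _.
by rewrite lee_fin; exact: eta_restrict_ge0 hypH _.
Qed.

Lemma weight_ge0 i : (0 <= weight i)%R.
Proof.
rewrite mulr_ge0 ?fine_entry_eta_ge0// exprn_ge0// ltW//.
exact: theta0_gt0 hypH.
Qed.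

(** The positivity hypothesis has no powers of theta0; since theta0 <= 1 and i <= t, each theta0^i
    is at least theta0^t. *)
Lemma sum_weight_gt0 : (0 < \sum_i weight i)%R.
Proof.
have th0 := theta0_gt0 hypH.
have : (0 < \sum_i fine (\int[entry i]_x ((eta \_ A0) x)%:E))%R.
  rewrite -lte_fin -sumEFin.
  rewrite (eq_bigr (fun i => \int[entry i]_x ((eta \_ A0) x)%:E))// => i _.
  by rewrite fineK//; exact: (integral_eta_fin mA hypH (entry_V i)).
rewrite -(pmulr_rgt0 _ (exprn_gt0 t th0)) => /lt_le_trans; apply.
rewrite mulr_sumr; apply: ler_sum => i _; apply: ler_wpM2r.
  exact: fine_entry_eta_ge0.
by apply: ler_wiXn2l; [exact: ltW|exact: theta0_le1 hypH|exact: ltnW].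
Qed.

(** A lower bound uniform in n, so that dividing by L_n(E) keeps the geometric rate. *)
Lemma limit_sum_setT_ge n :
  ((\sum_i weight i) * theta0 ^+ t <= L n setT)%R.
Proof.
rewrite mulr_suml; apply: ler_sum => i _; apply: ler_wpM2l.
  exact: weight_ge0.
exact: limit_mass_setT_ge hypH _.
Qed.

Lemma limit_sum_setT_gt0 n : (0 < L n setT)%R.
Proof.
apply: lt_le_trans (limit_sum_setT_ge n).
by rewrite mulr_gt0 ?sum_weight_gt0// exprn_gt0//; exact: theta0_gt0 hypH.
Qed.

Lemma limit_sum_period n k B : measurable B -> L (n + k * t) B = L n B.
Proof.
move=> mB; apply: eq_bigr => i _; congr (_ * _)%R.
rewrite [LHS](limit_mass_mod chainX mA perA hypH)//.
rewrite [RHS](limit_mass_mod chainX mA perA hypH)//.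
by rewrite addnAC addnC modnMDl.
Qed.

Lemma mass_mu_asymptotics : exists2 D : R, (0 <= D)%R & forall n B,
  measurable B -> (t <= n)%N ->
  (`|theta0 ^+ t / theta0 ^+ n * mass chainX mu n B - L n B|
    <= D * alpha ^+ ((n - t) %/ t))%R.
Proof.
have th0 := theta0_gt0 hypH; have [_ [_ CQ0 /andP[al0 _]] _ _ _] := hypH.
pose b i := fine (\int[entry i]_x ((V \_ A0) x)%:E).
have b0 i : (0 <= b i)%R.
  apply: fine_ge0; apply: integral_ge0 => x _.
  by rewrite lee_fin; exact: V_restrict_ge0 hypH _.
have tn0 n : (theta0 ^+ n != 0)%R by rewrite expf_neq0// gt_eqF.
(* The factor theta0^-t bounds the theta0^-r below, where r < t is the remainder of n - t. *)
exists (\sum_(i < t) theta0 ^- t * CQ * b i)%R.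
  apply: sumr_ge0 => i _; rewrite !mulr_ge0// invr_ge0 exprn_ge0//.
  exact: ltW.
move=> n B mB tn; set k := ((n - t) %/ t)%N.
rewrite mass_class_part// mulr_sumr -sumrB mulr_suml.
apply: (le_trans (ler_norm_sum _ _ _)); apply: ler_sum => i _.
pose r := ((n - t) %% t)%N.
have nE : n = (t + (k * t + r))%N by rewrite -divn_eq subnKC.
(* After the t - i steps from A_i to A_0, the remaining time is k periods and r + i steps; r + i may
   exceed t. *)
have nEi : n = ((t - i) + (k * t + (r + i)))%N.
  rewrite [LHS]nE addnCA [RHS]addnCA; congr addn.
  by rewrite [(r + i)%N]addnC addnA subnK// ltnW.
have -> : w (n + i) B = w (r + i) B.
  rewrite [LHS](limit_mass_mod chainX mA perA hypH)//.
  rewrite [RHS](limit_mass_mod chainX mA perA hypH)//.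
  by rewrite nE -addnA modnDl -addnA modnMDl.
rewrite {2}nEi -mass_bind//.
have rt : (r <= t)%N by rewrite ltnW// ltn_mod.
have := mass_asymptotics chainX mA perA hypH k (r + i) mB
  (entry_concentrated i) (entry_V i).
rewrite -/(b i) -/(entry i).
set p := mass _ _ _ _; set a := fine _; set q := N _ _ => h.
(* Both terms carry theta0^-r: the first since n - t = kt + r, the second since theta0^i
   theta0^-(r+i) = theta0^-r. *)
have -> : (theta0 ^+ t / theta0 ^+ n * p - weight i * w (r + i) B =
    theta0 ^- r * (theta0 ^- (k * t) * p - a * q))%R.
  rewrite /weight /limit_mass -/a -/q nE !exprD; field.
  by rewrite !tn0.
rewrite normrM ger0_norm; last by rewrite invr_ge0 exprn_ge0// ltW.
have -> : (theta0 ^- t * CQ * b i * alpha ^+ k =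
   theta0 ^- t * (CQ * alpha ^+ k * b i))%R by ring.
apply: ler_pM => //; first by rewrite invr_ge0 exprn_ge0// ltW.
rewrite lef_pV2 ?posrE ?exprn_gt0//.
by apply: ler_wiXn2l => //; [exact: ltW|exact: theta0_le1 hypH].
Qed.

Lemma cond_law_asymptotics : exists2 G : R, (0 <= G)%R & forall n B,
  measurable B -> (t <= n)%N ->
  (`|cond_law P X mu n B - L n B / L n setT| <= G * alpha ^+ ((n - t) %/ t))%R.
Proof.
have th0 := theta0_gt0 hypH; have [_ [_ _ /andP[al0 _]] _ _ _] := hypH.
have [D D0 HD] := mass_mu_asymptotics.
pose c := ((\sum_i weight i) * theta0 ^+ t)%R.
have c0 : (0 < c)%R by rewrite mulr_gt0 ?sum_weight_gt0// exprn_gt0.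
(* The constant of [ratio_dist], with L_n(E) replaced by its lower bound c. *)
exists (2 * D / c)%R; first by apply: divr_ge0; [exact: mulr_ge0|exact: ltW].
move=> n B mB tn; rewrite (cond_lawE chainX).
(* The scaling of the mass asymptotics, which cancels in the conditional law. *)
pose s : R := (theta0 ^+ t / theta0 ^+ n)%R.
have s0 : (0 < s)%R by rewrite divr_gt0 ?exprn_gt0.
have -> : (mass chainX mu n B / mass chainX mu n setT =
   (s * mass chainX mu n B) / (s * mass chainX mu n setT))%R.
  by rewrite -mulf_div divff ?gt_eqF// mul1r.
have e0 : (0 <= D * alpha ^+ ((n - t) %/ t))%R.
  by rewrite mulr_ge0// exprn_ge0// ltW.
apply: (le_trans (ratio_dist (e := (D * alpha ^+ ((n - t) %/ t))%R) _ _ _ _)).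
- rewrite mulr_ge0 ?mass_ge0 ?(ltW s0)//= ler_pM2l//.
  exact: mass_le.
- exact: limit_sum_setT_gt0.
- exact: HD.
- exact: HD.
have -> : (2 * D / c * alpha ^+ ((n - t) %/ t) =
  2 * (D * alpha ^+ ((n - t) %/ t)) / c)%R by ring.
apply: ler_wpM2l; first by apply: mulr_ge0.
rewrite lef_pV2 ?posrE ?limit_sum_setT_gt0//.
exact: limit_sum_setT_ge.
Qed.

End conditional_limits.

(** * The equivalence *)

Lemma tv_dist_ub (R : realType) (d : measure_display) (E : measurableType d)
    (m1 m2 : set E -> R) (B : set E) : measurable B ->
  ((`|m1 B - m2 B|)%:E <= tv_dist m1 m2)%E.
Proof. by move=> mB; apply: ereal_sup_ubound; exists B. Qed.

Section quasi_stationary_limit.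
Local Open Scope ereal_scope.
Context (R : realType) (d dO : measure_display).
Context (E : measurableType d) (Om : measurableType dO).
Variable P : R.-pker cemetery E ~> Om.
Variable X : nat -> Om -> cemetery E.
Hypothesis chainX : absorbed_markov_chain P X.
Variables (t : nat) (t_gt0 : (0 < t)%N) (A : 'I_t -> set E).
Hypothesis mA : forall i, measurable (A i).
Hypothesis perA : periodic_partition P X A.
Local Notation A0 := (A (Ordinal t_gt0)).
Variables (V : E -> R) (theta0 CQ alpha : R) (eta : E -> R).
Variable nu : probability E R.
Hypothesis hypH : assumption_H P X t A0 V theta0 CQ alpha eta nu.

Local Notation K := (transition chainX).
Local Notation N := (mass chainX nu).
Local Notation w := (limit_mass chainX theta0 nu).

(** The quasi-stationary distribution before normalization. *)
Definition cycle_mass B : R := (\sum_(i < t) w i B)%R.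
Local Notation W := cycle_mass.

Lemma cycle_mass_shift n B : measurable B -> (\sum_(i < t) w (n + i) B = W B)%R.
Proof.
move=> mB; apply: (sum_periodic (v := w ^~ B)) => j.
exact: (limit_massDt chainX mA perA hypH).
Qed.

Lemma cycle_mass_setT_gt0 : (0 < W setT)%R.
Proof.
have w0 i : (0 < w i setT)%R.
  apply: lt_le_trans (limit_mass_setT_ge _ mA perA hypH i).
  by rewrite exprn_gt0//; exact: theta0_gt0 hypH.
rewrite /cycle_mass (bigD1 (Ordinal t_gt0))//=.
by rewrite ltr_pwDl// sumr_ge0// => i _; exact: ltW.
Qed.

Let scale_ge0 n : (0 <= theta0 ^- n)%R.
Proof. by rewrite invr_ge0 exprn_ge0// ltW//; exact: theta0_gt0 hypH. Qed.

(** nu_i as a measure, so that [mnormalize] and linearity of the integral in the measure become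
    available. *)
Let cycle_part (i : nat) : {measure set E -> \bar R} :=
  mscale (NngNum (scale_ge0 i)) (giry_bind nu (measurable_transition chainX i)).

Let cycle_measure : {measure set E -> \bar R} := msum cycle_part t.

(* nu is only the value [mnormalize] takes on null or infinite measures. *)
Definition qsd : probability E R := mnormalize cycle_measure nu.

Let cycle_measureE B : measurable B -> cycle_measure B = (W B)%:E.
Proof.
move=> mB; rewrite /cycle_measure/= /msum -sumEFin; apply: eq_bigr => i _.
rewrite /cycle_part/= /mscale/= EFinM -mass_int//.
by congr (_ * _); exact: giry_bindE.
Qed.

Lemma qsdE B : measurable B -> qsd B = (W B / W setT)%:E.
Proof.
move=> mB; rewrite /qsd/= /mnormalize !cycle_measureE// ifF; last first.
  by rewrite orbF eqe gt_eqF// cycle_mass_setT_gt0.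
by rewrite cycle_measureE// -EFinM.
Qed.

(** P_n sends nu_i to theta0^n nu_(n+i), and the sum over a full period is invariant under the shift
    by n. *)
Lemma mass_qsd n B : measurable B ->
  (mass chainX qsd n B = theta0 ^+ n * (W B / W setT))%R.
Proof.
move=> mB; have W0 := cycle_mass_setT_gt0.
have Wi : (0 <= (W setT)^-1)%R by rewrite invr_ge0 ltW.
have mK := measurable_transition_set chainX n mB.
have th0 := theta0_gt0 hypH.
have tn0 k : (theta0 ^+ k != 0)%R by rewrite expf_neq0// gt_eqF.
suff : \int[qsd]_x K n x B = (theta0 ^+ n * (W B / W setT))%:E.
  by rewrite /mass => ->.
rewrite (eq_measure_integral (mscale (NngNum Wi) cycle_measure)); last first.
  move=> C mC _; apply: etrans (qsdE mC) _.
  by rewrite /= /mscale cycle_measureE// -EFinM mulrC.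
rewrite ge0_integral_mscale// ge0_integral_measure_sum//.
rewrite -(cycle_mass_shift n mB) mulrA mulrC EFinM /=.
congr (_ * _).
rewrite mulr_sumr -sumEFin; apply: eq_bigr => i _.
rewrite ge0_integral_mscale//=; last first.
  by move=> x _; exact: (measure_ge0 (K n x)).
rewrite (etrans (mass_int _ _ _ mB) (congr1 EFin (mass_bind _ nu i n mB))).
rewrite -EFinM; congr EFin.
by rewrite /limit_mass addnC exprD; field; rewrite !tn0.
Qed.

Lemma quasi_stationary_qsd : quasi_stationary P X qsd.
Proof.
move=> n B mB; rewrite (cond_lawE chainX) qsdE// !mass_qsd//; congr EFin.
have W0 := cycle_mass_setT_gt0; have th0 := theta0_gt0 hypH.
by field; rewrite expf_neq0 ?gt_eqF.
Qed.

End quasi_stationary_limit.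

Lemma cvg_geometric_divn (R : realType) (G alpha : R) t : (0 < t)%N ->
  0 < alpha < 1 -> G * alpha ^+ ((n - t) %/ t) @[n --> \oo] --> (0 : R).
Proof.
move=> t0 /andP[al0 al1].
have Da : geometric G alpha k @[k --> \oo] --> (0 : R).
  by apply: cvg_geometric; rewrite gtr0_norm.
(* From this rank on, (n - t) / t is at least [n0]. *)
apply: cvg_comp Da => /= S [n0 _ Sn]; exists (t + n0 * t)%N => // n /= nn.
apply: Sn => /=; rewrite leq_divRL//.
by rewrite leq_subRL// (leq_trans _ nn)// leq_addr.
Qed.

Section equivalence.
Local Open Scope ereal_scope.
Context (R : realType) (d dO : measure_display).
Context (E : measurableType d) (Om : measurableType dO).
Variable P : R.-pker cemetery E ~> Om.
Variable X : nat -> Om -> cemetery E.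
Hypothesis chainX : absorbed_markov_chain P X.
Variables (t : nat) (t_gt0 : (0 < t)%N) (A : 'I_t -> set E).
Hypothesis mA : forall i, measurable (A i).
Hypothesis perA : periodic_partition P X A.
Local Notation A0 := (A (Ordinal t_gt0)).
Variables (V : E -> R) (theta0 CQ alpha : R) (eta : E -> R).
Variable nu : probability E R.
Hypothesis hypH : assumption_H P X t A0 V theta0 CQ alpha eta nu.
Variable mu : probability E R.
Hypothesis entry_V : forall i,
  \int[entry chainX mA mu i]_x ((V \_ A0) x)%:E < +oo.
Hypothesis entry_eta :
  0 < \sum_(i < t) \int[entry chainX mA mu i]_x ((eta \_ A0) x)%:E.

Local Notation w := (limit_mass chainX theta0 nu).
Local Notation weight := (weight chainX t_gt0 mA theta0 eta mu).
Local Notation L := (limit_sum chainX t_gt0 mA theta0 eta nu mu).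

(** With equal weights, L_n(B) / L_n(E) is exactly the mass of B under [qsd], for every n, and the
    error bound is uniform in B. *)
Lemma tv_dist_qsd_cvg : (forall i j, weight i = weight j) ->
  tv_dist (cond_law P X mu n) (fun B => fine (qsd chainX hypH B))
    @[n --> \oo] --> 0.
Proof.
move=> wc; have al := alpha_itv hypH.
have [G G0 HG] := cond_law_asymptotics perA hypH entry_V entry_eta.
have LE n B : measurable B -> (L n B / L n setT = fine (qsd chainX hypH B))%R.
  move=> mB; rewrite qsdE//=.
  have LW C : measurable C ->
      (L n C = weight (Ordinal t_gt0) * cycle_mass chainX t theta0 nu C)%R.
    move=> mC; rewrite -(cycle_mass_shift chainX mA perA hypH n mC) mulr_sumr.
    by apply: eq_bigr => i _; rewrite (wc i (Ordinal t_gt0)).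
  rewrite !LW//; have := limit_sum_setT_gt0 perA hypH entry_V entry_eta n.
  rewrite LW// => c0; rewrite -mulf_div divff ?mul1r//.
  by apply: contraTneq c0 => ->; rewrite mul0r ltxx.
apply: (squeeze_cvge (f := cst 0)
    (h := fun n => (G * alpha ^+ ((n - t) %/ t))%:E)); last 2 first.
- exact: cvg_cst.
- by apply: cvg_EFin; [exact: nearW|exact: cvg_geometric_divn].
exists t => // n /= tn; apply/andP; split.
  (* The empty set witnesses that the supremum is nonnegative. *)
  by apply: le_trans (tv_dist_ub _ _ measurable0); rewrite lee_fin.
by apply: ge_ereal_sup => _ [B mB <-]; rewrite lee_fin -(LE n)//; exact: HG.
Qed.

Lemma weight_constant (pi : set E -> R) :
  tv_dist (cond_law P X mu n) pi @[n --> \oo] --> 0 ->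
  forall i j, weight i = weight j.
Proof.
move=> cvpi; have al := alpha_itv hypH.
have [G G0 HG] := cond_law_asymptotics perA hypH entry_V entry_eta.
have L0 := limit_sum_setT_gt0 perA hypH entry_V entry_eta.
(* The quotient has the same value along n + kt, so it equals its limit for every n and not only
   asymptotically. *)
have piL n B : measurable B -> pi B = (L n B / L n setT)%R.
  move=> mB; apply/eqP; rewrite -subr_eq0 -normr_eq0 eq_le normr_ge0 andbT.
  apply/ler_addgt0Pr => e e0; rewrite add0r.
  have e20 : (0 < e / 2)%R by rewrite divr_gt0.
  have near1 : \forall m \near \oo,
      tv_dist (cond_law P X mu m) pi < (e / 2)%:E.
    by apply: (cvpi (fun y => y < (e / 2)%:E)); exact: open_ereal_lt_ereal.
  have near2 : \forall m \near \oo, (G * alpha ^+ ((m - t) %/ t) < e / 2)%R.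
    have := cvg_geometric_divn G t_gt0 al; move/cvgr_lt; exact.
  have [n1 _ near12] := filterI near1 near2.
  (* A time congruent to n modulo t, beyond both [n1] and t. *)
  pose m := (n + (n1 + t) * t)%N.
  have mn1 : (n1 <= m)%N.
    by rewrite (leq_trans (leq_addr t n1))// (leq_trans (leq_pmulr _ t_gt0))// leq_addl.
  have mt : (t <= m)%N.
    by rewrite (leq_trans (leq_addl n1 t))// (leq_trans (leq_pmulr _ t_gt0))// leq_addl.
  have [/= tv1 G1] := near12 m mn1.
  have := HG m B mB mt.
  rewrite !(limit_sum_period chainX mA perA hypH)// => h1.
  have h2 : (`|cond_law P X mu m B - pi B| < e / 2)%R.
    by rewrite -lte_fin; apply: le_lt_trans tv1; exact: tv_dist_ub.
  have := le_lt_trans h1 G1; set q := (L n B / _)%R => h3.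
  rewrite ltW// (splitr e) (_ : pi B - q = - (cond_law P X mu m B - pi B)
    + (cond_law P X mu m B - q))%R; last by ring.
  by apply: (le_lt_trans (ler_normD _ _)); rewrite normrN ltrD.
pose lw (l : 'I_t) := w l setT.
have lw0 l : (0 < lw l)%R.
  apply: lt_le_trans (limit_mass_setT_ge _ mA perA hypH l).
  by rewrite exprn_gt0//; exact: theta0_gt0 hypH.
have wA j l : (w j (A l) = if (j %% t == l)%N then lw l else 0)%R.
  rewrite (limit_mass_class chainX mA perA hypH); case: eqP => //; rewrite /lw => <-.
  by rewrite [LHS](limit_mass_mod chainX mA perA hypH).
(* Dividing by the mass of nu_l and summing over the classes forgets n. *)
pose p := (\sum_l pi (A l) / lw l)%R.
have sumL n : (p * L n setT = \sum_i weight i)%R.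
  rewrite mulr_suml.
  transitivity (\sum_(l < t) \sum_(i < t)
      (if ((n + i) %% t == l)%N then weight i else 0))%R.
    apply: eq_bigr => l _; rewrite (piL n)// mulrAC divfK ?gt_eqF//.
    rewrite mulr_suml; apply: eq_bigr => i _; rewrite wA; case: ifP => _.
      by rewrite mulfK ?gt_eqF.
    by rewrite mulr0 mul0r.
  (* For fixed i, only the class l = (n + i) mod t contributes. *)
  rewrite exchange_big; apply: eq_bigr => i _.
  have ni : ((n + i) %% t < t)%N by rewrite ltn_mod.
  rewrite (bigD1 (Ordinal ni))//= eqxx big1 ?addr0// => l ln.
  case: eqP => // h; case/eqP: ln; exact: val_inj.
have p0 : (p != 0)%R.
  apply: contraTneq (sum_weight_gt0 hypH entry_V entry_eta) => p0.
  by rewrite -(sumL 0%N) p0 mul0r ltxx.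
have LT n : L n setT = L 0%N setT by apply: (mulfI p0); rewrite !sumL.
(* At n = t - i, only the term of index i charges A_0: for k < t, t divides t - i + k only when k =
   i. *)
have wi i : (weight i * lw (Ordinal t_gt0)
    = pi (A (Ordinal t_gt0)) * L 0%N setT)%R.
  rewrite -(LT (t - i)%N) (piL (t - i)%N)// divfK ?gt_eqF//.
  rewrite /limit_sum (bigD1 i)//= wA subnK 1?ltnW// modnn eqxx.
  rewrite big1 ?addr0// => k ki; rewrite wA; case: eqP => [|_]; last by rewrite mulr0.
  move=> /= h; case/eqP: ki; apply: val_inj.
  have : (t - i + k = t - i + i %[mod t])%N by rewrite subnK 1?ltnW// modnn.
  by move/eqP; rewrite eqn_modDl !modn_small// => /eqP.
by move=> i j; apply: (mulIf (lt0r_neq0 (lw0 (Ordinal t_gt0)))); rewrite !wi.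
Qed.

End equivalence.

Theorem mainTheorem5 (R : realType) (d dO : measure_display)
    (E : measurableType d) (Om : measurableType dO)
    (P : R.-pker cemetery E ~> Om) (X : nat -> Om -> cemetery E)
    (chainX : absorbed_markov_chain P X)
    (t : nat) (t_gt0 : (0 < t)%N) (A : 'I_t -> set E)
    (mA : forall i, measurable (A i)) (perA : periodic_partition P X A)
    (V : E -> R) (theta0 CQ alpha : R) (eta : E -> R) (nu : probability E R)
    (hypH : assumption_H P X t (A (Ordinal t_gt0)) V theta0 CQ alpha eta nu)
    (mu : probability E R)
    (muV : (\sum_(i < t) measure_semigroup P X (mrestr mu (mA i)) (t - i)
              (V \_ (A (Ordinal t_gt0))) < +oo)%E)
    (mueta : (0 < \sum_(i < t) measure_semigroup P X (mrestr mu (mA i)) (t - i)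
                (eta \_ (A (Ordinal t_gt0))))%E) :
  (exists2 pi : probability E R, quasi_stationary P X pi &
     tv_dist (cond_law P X mu n) (fun B => fine (pi B)) @[n --> \oo] --> 0%E)
  <->
  (forall i j : 'I_t,
     ((theta0 ^+ i)%:E * measure_semigroup P X (mrestr mu (mA i)) (t - i)
        (eta \_ (A (Ordinal t_gt0))))%E =
     ((theta0 ^+ j)%:E * measure_semigroup P X (mrestr mu (mA j)) (t - j)
        (eta \_ (A (Ordinal t_gt0))))%E).
Proof.
set A0 := A (Ordinal t_gt0).
have entryV i : measure_semigroup P X (mrestr mu (mA i)) (t - i) (V \_ A0) =
    (\int[entry chainX mA mu i]_x ((V \_ A0) x)%:E)%E.
  exact: (measure_semigroup_entry chainX mA mu i
    (measurable_V_restrict mA hypH) (V_restrict_ge0 hypH)).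
have entryeta i : measure_semigroup P X (mrestr mu (mA i)) (t - i) (eta \_ A0) =
    (\int[entry chainX mA mu i]_x ((eta \_ A0) x)%:E)%E.
  exact: (measure_semigroup_entry chainX mA mu i
    (measurable_eta_restrict mA hypH) (eta_restrict_ge0 hypH)).
(* The terms are nonnegative, so finiteness of the sum gives finiteness of each. *)
have V_fin i : (\int[entry chainX mA mu i]_x ((V \_ A0) x)%:E < +oo)%E.
  apply: le_lt_trans muV; rewrite (bigD1 i)//= entryV leeDl//.
  apply: sume_ge0 => k _; rewrite entryV; apply: integral_ge0 => x _.
  by rewrite lee_fin; exact: V_restrict_ge0 hypH _.
have eta_pos : (0 < \sum_(i < t) \int[entry chainX mA mu i]_x ((eta \_ A0) x)%:E)%E.
  by rewrite (eq_bigr _ (fun i _ => esym (entryeta i))).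
have weightE (i : 'I_t) : ((theta0 ^+ i)%:E *
    measure_semigroup P X (mrestr mu (mA i)) (t - i) (eta \_ A0) =
    (weight chainX t_gt0 mA theta0 eta mu i)%:E)%E.
  by rewrite entryeta EFinM fineK//; exact: (integral_eta_fin mA hypH (V_fin i)).
split=> [[pi _ cvpi] i j|wc].
  by rewrite !weightE (weight_constant perA hypH V_fin eta_pos cvpi i j).
exists (qsd chainX hypH); first exact: quasi_stationary_qsd.
apply: tv_dist_qsd_cvg => // i j; apply: EFin_inj.
by rewrite -!weightE.
Qed.
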